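(* Let $0\le\gamma<1$, $\alpha=\frac{4}{3+\gamma}$, and let $\Omega\subset\mathbb{R}^n$ be a bounded smooth domain. Given $\Omega'\Subset\Omega$, there exist positive constants $C$ and $\kappa_\star$ depending on $\gamma$, $\|u\|_{L^\infty(\Omega)}$, $\mathrm{dist}(\Omega',\partial\Omega)$ and the dimension $n$, but independent of $\varepsilon>0$, such that if $u$ is a (bounded) positive viscosity solution of $$\Delta_\infty u=\mathcal{B}_\varepsilon(u)\,u^{-\gamma}\quad\text{in }\Omega,$$ then $$\sup_{B_\kappa(x)}u\le C\left(\kappa^\alpha+u(x)\right)$$ for any $x\in\Omega'$ and $0<\kappa\le\kappa_\star$.
   Context: $\Delta_\infty u=\sum_{i,j}D_{ij}u\,D_iu\,D_ju$, understood in the viscosity sense. Fix $\delta=\frac12\alpha^{-4/(3+\gamma)}$ and a Lipschitz function $\mathcal{B}:\mathbb{R}\to\mathbb{R}$ with $0\le\mathcal{B}\le1$, $\mathcal{B}(s)=0$ for $s\le\delta/2$ and $\mathcal{B}(s)=1$ for $s\ge\delta$. For $\varepsilon>0$ put $\mathcal{B}_\varepsilon(s)=\mathcal{B}(s/\varepsilon^\alpha)$. *)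

(* Defs.v *)
From HB Require Import structures.
From mathcomp Require Import all_boot all_order all_algebra.
From mathcomp Require Import all_classical all_reals all_analysis.

Set Implicit Arguments.
Unset Strict Implicit.
Unset Printing Implicit Defensive.

Import Order.TTheory GRing.Theory Num.Theory.
Import numFieldNormedType.Exports.

Local Open Scope classical_set_scope.
Local Open Scope ring_scope.

Section Rn.
Context {R : realType} {n : nat}.
Implicit Types (U Omega A B : set 'rV[R]_n) (u f phi : 'rV[R]_n -> R).

(* The library norm on 'rV[R]_n is the sup norm: it induces the usual topology,
   but balls, distances and the infinity Laplacian are Euclidean. *)
Definition enorm (x : 'rV[R]_n) : R := Num.sqrt (\sum_(i < n) x 0 i ^+ 2).

Definition eball (x : 'rV[R]_n) (r : R) : set 'rV[R]_n :=
  [set y | enorm (y - x) < r].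

(* Equal to +oo when A or B is empty. *)
Definition dist_set A B : \bar R :=
  ereal_inf [set (enorm (x - y))%:E | x in A & y in B].

Definition boundary A : set 'rV[R]_n := closure A `\` interior A.

Definition compactly_contained A B : Prop :=
  compact (closure A) /\ closure A `<=` B.

Definition partial (i : 'I_n) f : 'rV[R]_n -> R :=
  fun x => 'D_('e_i) f x.

(* C^k on an open set U: all iterated partial derivatives of order at most k
   exist and are continuous on U. *)
Fixpoint Ck (k : nat) U f : Prop :=
  {within U, continuous f} /\
  match k with
  | 0%N => True
  | k'.+1 => forall i : 'I_n,
      (forall x, U x -> derivable f x 'e_i) /\ Ck k' U (partial i f)
  end.

Definition smooth_on U f : Prop := forall k, Ck k U f.

(* The boundary is locally the zero set of a smooth function with nonvanishing
   gradient, the set lying on one side of it. *)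
Definition smooth_boundary Omega : Prop :=
  forall x0, boundary Omega x0 ->
    exists (U : set 'rV[R]_n) (rho : 'rV[R]_n -> R),
      [/\ open U, U x0, smooth_on U rho,
          exists i, partial i rho x0 != 0
        & Omega `&` U = [set x | U x /\ rho x < 0]].

Definition bounded_smooth_domain Omega : Prop :=
  [/\ open Omega, connected Omega, Omega !=set0,
      bounded_set Omega & smooth_boundary Omega].

(* Lebesgue null sets of R^n, through countable coverings by boxes. *)
Definition lebesgue_null A : Prop :=
  forall e : R, 0 < e ->
    exists a b : nat -> 'rV[R]_n,
      [/\ forall k i, a k 0 i <= b k 0 i,
          A `<=` \bigcup_k [set x | forall i, a k 0 i <= x 0 i <= b k 0 i]
        & (\sum_(0 <= k <oo) (\prod_(i < n) (b k 0 i - a k 0 i))%:E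
             <= e%:E)%E].

Definition Linfty_norm Omega u : \bar R :=
  ereal_inf [set y%:E | y in
    [set y : R | 0 <= y /\ lebesgue_null [set x | Omega x /\ y < `|u x|]]].

Definition inf_laplacian phi (x : 'rV[R]_n) : R :=
  \sum_(i < n) \sum_(j < n)
    partial i (partial j phi) x * partial i phi x * partial j phi x.

Definition viscosity_subsolution Omega (g : R -> R) u : Prop :=
  forall x0 U phi, Omega x0 -> open U -> U x0 -> Ck 2 U phi ->
    (\forall x \near x0, u x - phi x <= u x0 - phi x0) ->
    g (u x0) <= inf_laplacian phi x0.

Definition viscosity_supersolution Omega (g : R -> R) u : Prop :=
  forall x0 U phi, Omega x0 -> open U -> U x0 -> Ck 2 U phi ->
    (\forall x \near x0, u x0 - phi x0 <= u x - phi x) ->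
    inf_laplacian phi x0 <= g (u x0).

(* Viscosity solutions of inf_laplacian u = g(u) in Omega. *)
Definition viscosity_solution Omega (g : R -> R) u : Prop :=
  [/\ {within Omega, continuous u},
      viscosity_subsolution Omega g u & viscosity_supersolution Omega g u].

End Rn.

Section Absorption.
Context {R : realType}.
Implicit Types (gamma eps s : R) (B : R -> R).

Definition alpha gamma : R := 4 / (3 + gamma).

Definition delta gamma : R := 2^-1 * alpha gamma `^ (- (4 / (3 + gamma))).

Definition cutoff gamma B : Prop :=
  [/\ [lipschitz B s | s in [set: R]],
      forall s, 0 <= B s <= 1,
      forall s, s <= delta gamma / 2 -> B s = 0
    & forall s, delta gamma <= s -> B s = 1].

Definition cutoff_eps gamma B eps s : R := B (s / eps `^ alpha gamma).

End Absorption.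

(* Main.v *)
Require Import Defs.
From HB Require Import structures.
From mathcomp Require Import all_boot all_order all_algebra.
From mathcomp Require Import all_classical all_reals all_analysis.
From mathcomp Require Import ring lra.

Set Implicit Arguments.
Unset Strict Implicit.
Unset Printing Implicit Defensive.

Import Order.TTheory GRing.Theory Num.Theory.
Import numFieldNormedType.Exports.

Local Open Scope classical_set_scope.
Local Open Scope ring_scope.

(** Fix y in B_kappa(x), put T = u(y), and choose c with T = c (2 kappa)^alpha.
    If c is at most a constant c0(gamma), then T <= C kappa^alpha.
    Otherwise w(z) = c (rho - |z - y|)_+^alpha satisfies Delta_oo w > w^-gamma on
    0 < |z - y| < rho, because 3 alpha - 4 = - alpha gamma.  Comparison fails
    for the decreasing absorption s^-gamma, so rho is increased from 0 to
    2 kappa instead: at a first touching point the values of u and w agree and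
    the supersolution property is contradicted.  Hence w <= u for
    rho = 2 kappa, and u(x) >= c kappa^alpha = 2^-alpha T. *)

(** * Directional derivatives and the infinity Laplacian of radial functions *)

Section DirectionalDerivatives.
Context {R : realType} {n : nat}.
Implicit Types (U : set 'rV[R]_n) (x y v : 'rV[R]_n).

(** Restricting to a line brings the one-variable derivative rules, above all the chain rule, to
    directional derivatives without passing through Fréchet differentials. *)
Lemma is_derive_lineP (f : 'rV[R]_n -> R) x v l :
  is_derive x v f l <-> is_derive (0 : R) 1 (fun t => f (t *: v + x)) l.
Proof.
have E : 'D_v f x = 'D_1 (fun t : R => f (t *: v + x)) 0.
  rewrite /derive; set g1 := fun h => h^-1 *: _; set g2 := fun h => h^-1 *: _.
  suff -> : g1 = g2 by [].
  by apply: funext => t; rewrite /g1 /g2 /= addr0 scale0r add0r [_%:A]mulr1.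
split=> -[df <-]; split; rewrite ?E//.
  by move/derivable1P : df.
by apply/derivable1P.
Qed.

Lemma is_derive_line_comp (h : R -> R) (q : 'rV[R]_n -> R) x v dh dq :
  is_derive (q x) 1 h dh -> is_derive x v q dq ->
  is_derive x v (fun y => h (q y)) (dh * dq).
Proof.
move=> hq /is_derive_lineP qx; apply/is_derive_lineP.
apply: (@is_derive1_comp R h (fun t => q (t *: v + x))) => //.
by rewrite scale0r add0r.
Qed.

Lemma is_derive_coordB x y v j :
  is_derive x v (fun z => (z - y) 0 j) (v 0 j).
Proof.
apply/is_derive_lineP.
rewrite (_ : (fun t : R => _) = (fun t => t * v 0 j + (x - y) 0 j)); last first.
  by apply: funext => t; rewrite !mxE addrA.
by apply: is_derive_eq; rewrite addr0 scaler0 add0r /GRing.scale/= mulr1.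
Qed.

(** The square is a polynomial in the coordinates, hence smooth even at [y], where [enorm (x - y)]
    is not; radial functions are therefore written as profiles of s = |x - y|^2. *)
Definition sqdist y x : R := \sum_(j < n) (x - y) 0 j ^+ 2.

Lemma is_derive_sqdist x y v :
  is_derive x v (sqdist y) (2 * \sum_(j < n) (x - y) 0 j * v 0 j).
Proof.
have -> : sqdist y = \sum_(j < n) (fun z => (z - y) 0 j) ^+ 2.
  by apply: funext => z; rewrite fct_sumE.
have D j := is_derive_coordB x y v j.
apply: is_derive_eq; rewrite mulr_sumr; apply: eq_bigr => j _.
by rewrite expr1 /GRing.scale /= mulrA.
Qed.

Lemma coordB_continuous y j : continuous (fun z : 'rV[R]_n => (z - y) 0 j).
Proof.
rewrite (_ : (fun z => _) = (fun z : 'rV[R]_n => z 0 j - y 0 j)); last first.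
  by apply: funext => z; rewrite !mxE.
move=> x; apply: continuousB; last exact: cst_continuous.
by have := @coord_continuous R 1 n 0 j x.
Qed.

Lemma sqdist_continuous y : continuous (sqdist y).
Proof.
apply: continuous_big => [|j _]; first exact: add_continuous.
move=> x; apply: (@continuous_comp _ _ _ (fun z : 'rV[R]_n => (z - y) 0 j)
  (fun t => t ^+ 2)); [exact: coordB_continuous|exact: exprn_continuous].
Qed.

(** The candidate gradient [G] and Hessian [H] match the iterated [partial]s only on [U]. As [U] is
    open, they match near each of its points, which is enough to transfer both derivatives and
    continuity. *)
Lemma Ck2_intro U (f : 'rV[R]_n -> R) (G : 'I_n -> 'rV[R]_n -> R)
    (H : 'I_n -> 'I_n -> 'rV[R]_n -> R) :
  open U ->
  (forall i x, U x -> is_derive x 'e_i f (G i x)) ->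
  (forall i j x, U x -> is_derive x 'e_i (G j) (H i j x)) ->
  (forall x, U x -> {for x, continuous f}) ->
  (forall i x, U x -> {for x, continuous (G i)}) ->
  (forall i j x, U x -> {for x, continuous (H i j)}) ->
  Ck 2 U f /\ forall x, U x ->
    inf_laplacian f x = \sum_(i < n) \sum_(j < n) H i j x * G i x * G j x.
Proof.
move=> oU fG GH cf cG cH.
have near_eq (g1 g2 : 'rV[R]_n -> R) x : (forall z, U z -> g1 z = g2 z) ->
    U x -> \near x, g1 x = g2 x.
  move=> e Ux; have : nbhs x U by exact: open_nbhs_nbhs.
  by apply: filterS.
have within_c (g1 g2 : 'rV[R]_n -> R) : (forall z, U z -> g1 z = g2 z) ->
    (forall x, U x -> {for x, continuous g2}) -> {within U, continuous g1}.
  move=> e c2; apply: continuous_in_subspaceT => x /set_mem Ux.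
  have /c2 c2x := Ux; have ex := near_eq _ _ _ (fun z Uz => esym (e z Uz)) Ux.
  have := cvg_trans (near_eq_cvg ex) c2x.
  rewrite -(e x Ux). exact.
have pf i x : U x -> partial i f x = G i x by move=> /(fG i) [].
have D2 i j x : U x -> is_derive x 'e_i (partial j f) (H i j x).
  move=> Ux; apply: near_eq_is_derive (GH i j x Ux).
  by apply: near_eq => // z Uz; rewrite pf.
have ppf i j x : U x -> partial i (partial j f) x = H i j x.
  by move=> /(D2 i j) [].
split; last first.
  move=> x Ux; apply: eq_bigr => i _; apply: eq_bigr => j _.
  by rewrite ppf// !pf.
split; first exact: within_c cf.
move=> i; split; first by move=> x /(fG i) [].
split; first by apply: within_c (cG i) => z; exact: pf.
move=> j; split; first by move=> x /(D2 j i) [].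
by split=> //; apply: within_c (cH j i) => z; exact: ppf.
Qed.

(** With z = x - y, the gradient is 2 h' z and the Hessian is 2 h' Id + 4 h'' z z^T. Contracting the
    Hessian twice with the gradient and using |z|^2 = s gives the two terms. *)
Lemma radial_inf_laplacian (y : 'rV[R]_n) (I : set R) (h h1 h2 : R -> R) :
  open I ->
  (forall s, I s -> is_derive s 1 h (h1 s)) ->
  (forall s, I s -> is_derive s 1 h1 (h2 s)) ->
  (forall s, I s -> {for s, continuous h2}) ->
  let phi x := h (sqdist y x) in
  Ck 2 (sqdist y @^-1` I) phi /\
  forall x, I (sqdist y x) -> let s := sqdist y x in
    inf_laplacian phi x = 16 * s ^+ 2 * h1 s ^+ 2 * h2 s + 8 * s * h1 s ^+ 3.
Proof.
move=> oI hh1 hh2 ch2 phi.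
have oU : open (sqdist y @^-1` I).
  by apply: open_comp => // ? _; exact: sqdist_continuous.
have ch s : I s -> {for s, continuous h}.
  move=> /hh1 [/derivable1_diffP ? _]; exact: differentiable_continuous.
have ch1 s : I s -> {for s, continuous h1}.
  move=> /hh2 [/derivable1_diffP ? _]; exact: differentiable_continuous.
have cc (g : R -> R) x : {for sqdist y x, continuous g} ->
    {for x, continuous (fun z => g (sqdist y z))}.
  by move=> cg; have := continuous_comp (@sqdist_continuous y x) cg; exact.
have c2z i x : {for x, continuous (fun z : 'rV[R]_n => 2 * (z - y) 0 i)}.
  by apply: continuousM; [exact: cst_continuous|exact: coordB_continuous].
have de x i : is_derive x 'e_i (sqdist y) (2 * (x - y) 0 i).
  apply: is_derive_eq (is_derive_sqdist x y 'e_i) _; congr (_ * _).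
  rewrite (bigD1 i)//= big1 ?addr0 => [|j ji].
    by rewrite !mxE !eqxx mulr1.
  by rewrite [X in _ * X]mxE (negPf ji) andbF mulr0.
pose G i x := h1 (sqdist y x) * (2 * (x - y) 0 i).
pose H (i j : 'I_n) x := h1 (sqdist y x) * (2 * (i == j)%:R) +
  (2 * (x - y) 0 j) * (h2 (sqdist y x) * (2 * (x - y) 0 i)).
have [] := @Ck2_intro (sqdist y @^-1` I) phi G H oU.
- move=> i x Ix; apply: is_derive_line_comp; exact: hh1.
- move=> i j x Ix.
  have D1 : is_derive x 'e_i (fun z => h1 (sqdist y z))
    (h2 (sqdist y x) * (2 * (x - y) 0 i)).
    by apply: is_derive_line_comp; exact: hh2.
  have D2 := is_derive_coordB x y 'e_i j.
  have D3 : is_derive x 'e_i (fun z => 2 * (z - y) 0 j) (2 * (i == j)%:R).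
    have := @is_deriveZ _ _ _ (fun z => (z - y) 0 j) 2 x 'e_i _ D2.
    by rewrite mxE eqxx /= eq_sym.
  exact: (is_deriveM D1 D3).
- by move=> x /ch; exact: cc.
- by move=> i x /ch1/cc c1; exact: (continuousM c1 (c2z i x)).
- move=> i j x Ix; have c1 := cc _ _ (ch1 _ Ix); have c2 := cc _ _ (ch2 _ Ix).
  apply: (continuousD (continuousM c1 (@cst_continuous _ _ _ _))).
  exact: (continuousM (c2z j x) (continuousM c2 (c2z i x))).
move=> C2 L; split=> // x Ix s; rewrite L// {L} /H /G -/s.
(* The inner sum over j is carried out first: the identity part of the Hessian leaves only j = i,
   and the rank-one part produces a factor s. *)
transitivity (\sum_(i < n) (8 * h1 s ^+ 3 * (x - y) 0 i ^+ 2 +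
    16 * h1 s ^+ 2 * h2 s * s * (x - y) 0 i ^+ 2)).
  apply: eq_bigr => i _.
  under eq_bigr do rewrite 2!mulrDl.
  rewrite big_split/=; congr (_ + _).
    rewrite (bigD1 i)//= big1 ?addr0 => [|j ji]; first by rewrite eqxx mulr1; ring.
    by rewrite eq_sym (negPf ji) !(mulr0, mul0r).
  rewrite [in RHS]/s mulr_sumr mulr_suml; apply: eq_bigr => j _.
  by rewrite -/s; ring.
rewrite big_split/= -!mulr_sumr -/(sqdist y x) -/s; ring.
Qed.

End DirectionalDerivatives.

Lemma is_derive1_continuous (R : realType) (f : R -> R) (x l : R) :
  is_derive x 1 f l -> {for x, continuous f}.
Proof. by case=> /derivable1_diffP ? _; exact: differentiable_continuous. Qed.

(** * The barrier, and the lower bound for supersolutions that it gives *)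

Section Barrier.
Context {R : realType} {n : nat}.

(** For a function f of r = |x - y| the infinity Laplacian is f'^2 f''. Here f' = - c a w^(a-1) and
    f'' = c a (a-1) w^(a-2) with w = rho - r. The set [U] is the punctured ball, which avoids the
    kink of r at the centre and the zero of w on the sphere. *)
Lemma barrier_inf_laplacian (y : 'rV[R]_n) (c rho a : R) : 0 < rho ->
  let U := sqdist y @^-1` [set s | 0 < s < rho ^+ 2] in
  let phi x := c * (rho - enorm (x - y)) `^ a in
  [/\ open U, Ck 2 U phi & forall x, U x ->
    inf_laplacian phi x =
      c ^+ 3 * a ^+ 3 * (a - 1) * (rho - enorm (x - y)) `^ (3 * a - 4)].
Proof.
move=> rho0 U phi; set I := [set s : R | 0 < s < rho ^+ 2] in U *.
have oI : open I.
  rewrite (_ : I = `]0, rho ^+ 2[%classic); first exact: interval_open.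
  by apply/seteqP; split => s; rewrite /= in_itv.
have sI s : I s -> [/\ 0 < s, 0 < Num.sqrt s & 0 < rho - Num.sqrt s].
  move=> /andP[s0 sr]; split => //; first by rewrite sqrtr_gt0.
  by rewrite subr_gt0 -(ger0_norm (ltW rho0)) -sqrtr_sqr ltr_sqrt// exprn_gt0.
(* In the variable s = r^2, [P b] is w^b and [V] is 1/r. Derivatives of [P b] and [V] are again
   products of such functions, so [h1] and [h2] are the first two derivatives of c w^a in closed
   form. *)
pose P (b s : R) := (rho - Num.sqrt s) `^ b.
pose V (s : R) : R := (Num.sqrt s)^-1.
pose h1 (s : R) : R := - (c * a / 2) * (P (a - 1) s * V s).
pose h2 (s : R) := c * a / 4 *
  ((a - 1) * (P (a - 2) s * (V s * V s)) + P (a - 1) s * (V s * (V s * V s))).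
have dP b s : I s ->
    is_derive s 1 (P b) (- (b / 2) * (P (b - 1) s * V s)).
  move=> /sI[s0 r0 w0].
  have dw : is_derive s 1 (fun t => rho - Num.sqrt t) (- (2 * Num.sqrt s)^-1).
    have D := is_deriveB (is_derive_cst rho s 1) (is_derive1_sqrt s0).
    by apply: (is_derive_eq D); rewrite sub0r.
  have D := @is_derive1_comp R (fun t => t `^ b) (fun t => rho - Num.sqrt t)
    s _ _ (is_derive1_powR b w0) dw.
  apply: (is_derive_eq D).
  by rewrite /P /V invfM; ring.
have dV s : I s -> is_derive s 1 V (- 2^-1 * (V s * (V s * V s))).
  move=> /sI[s0 r0 w0].
  have D := is_deriveV (lt0r_neq0 r0) (is_derive1_sqrt s0).
  apply: (is_derive_eq D); rewrite /V /GRing.scale /=; field.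
  exact: lt0r_neq0.
have d1 s : I s -> is_derive s 1 (fun s => c * P a s) (h1 s).
  move=> /[dup] Is /(dP a) D.
  have D' := @is_deriveZ _ _ _ (P a) c s 1 _ D.
  by apply: (is_derive_eq D'); rewrite /h1 /GRing.scale /=; ring.
have d2 s : I s -> is_derive s 1 h1 (h2 s).
  move=> Is; have Da := dP (a - 1) s Is; have Dv := dV s Is.
  have D := @is_deriveZ _ _ _ _ (- (c * a / 2)) s 1 _ (is_deriveM Da Dv).
  apply: (is_derive_eq D); rewrite /h2 /GRing.scale /=.
  rewrite (_ : a - 1 - 1 = a - 2); last by ring.
  by field.
have c2 s : I s -> {for s, continuous h2}.
  move=> Is.
  have cP b := is_derive1_continuous (dP b s Is).
  have cV := is_derive1_continuous (dV s Is).
  have cK (k : R) : {for s, continuous (fun=> k)} by exact: cst_continuous.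
  apply: (continuousM (cK _)); apply: continuousD.
    exact: (continuousM (cK _) (continuousM (cP _) (continuousM cV cV))).
  exact: (continuousM (cP _) (continuousM cV (continuousM cV cV))).
have [Ckphi Lphi] := @radial_inf_laplacian R n y I _ _ _ oI d1 d2 c2.
split => //.
  by apply: open_comp => // ? _; exact: sqdist_continuous.
move=> x /[dup] Ux /sI; rewrite [LHS](Lphi x Ux) -[Num.sqrt _]/(enorm (x - y)).
move=> [s0 r0 w0].
have -> : sqdist y x = enorm (x - y) ^+ 2 by rewrite sqr_sqrtr// ltW.
rewrite /h1 /h2 /P /V sqrtr_sqr (gtr0_norm r0).
set r := enorm _ in r0 w0 *; set w := rho - r in w0 *.
have wn : w != 0 by exact: lt0r_neq0.
(* All powers of w are reduced to w^(a-2) and integer powers, which makes the identity a rational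
   one. In it the two terms in 1/r, one from [h2] and one from [h1 ^+ 3], cancel. *)
have -> : w `^ (a - 1) = w `^ (a - 2) * w.
  rewrite -[in X in _ * X](powRr1 (ltW w0)) -powRD ?wn ?implybT//.
  by congr (_ `^ _); ring.
have -> : w `^ (3 * a - 4) = w `^ (a - 2) ^+ 3 * w ^+ 2.
  rewrite -!powR_mulrn ?powR_ge0 ?(ltW w0)// -powRrM -powRD ?wn ?implybT//.
  by congr (_ `^ _); ring.
by field; exact: lt0r_neq0.
Qed.

(** * Euclidean balls against the sup-norm topology *)

Lemma mx_norm_le_enorm (x : 'rV[R]_n) : `|x| <= enorm x.
Proof.
rewrite [leLHS]/Num.norm /= mx_normrE; apply: bigmax_le; first exact: sqrtr_ge0.
move=> [i j] _ /=; rewrite (ord1 i) -sqrtr_sqr; apply: ler_wsqrtr.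
by rewrite (bigD1 j)//= lerDl; apply: sumr_ge0 => k _; exact: sqr_ge0.
Qed.

Lemma enormB_continuous (y : 'rV[R]_n) : continuous (fun x : 'rV[R]_n => enorm (x - y)).
Proof.
by move=> x; have := continuous_comp (@sqdist_continuous R n y x)
  (@sqrt_continuous R _); exact.
Qed.

Lemma enormN (x : 'rV[R]_n) : enorm (- x) = enorm x.
Proof. by congr Num.sqrt; apply: eq_bigr => i _; rewrite mxE sqrrN. Qed.

Lemma enormZ (t : R) (x : 'rV[R]_n) : enorm (t *: x) = `|t| * enorm x.
Proof.
rewrite /enorm -sqrtr_sqr -sqrtrM ?sqr_ge0// mulr_sumr; congr Num.sqrt.
by apply: eq_bigr => i _; rewrite mxE exprMn.
Qed.

Lemma enorm0 : enorm (0 : 'rV[R]_n) = 0.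
Proof. by rewrite -(scale0r 0) enormZ normr0 mul0r. Qed.

(** A coarse triangle inequality, coordinatewise from (x_i - y_i)^2 >= 0; its loss of a constant is
    absorbed by the choice of the largest admissible radius. *)
Lemma sqr_enormD_le (x y : 'rV[R]_n) :
  enorm (x + y) ^+ 2 <= 2 * (enorm x ^+ 2 + enorm y ^+ 2).
Proof.
have S (z : 'rV[R]_n) : enorm z ^+ 2 = \sum_(i < n) z 0 i ^+ 2.
  by rewrite sqr_sqrtr//; apply: sumr_ge0 => i _; exact: sqr_ge0.
rewrite !S -big_split/= mulr_sumr; apply: ler_sum => i _; rewrite mxE.
have := sqr_ge0 (x 0 i - y 0 i); rewrite !expr2; nra.
Qed.

Lemma compact_closed_eball (y : 'rV[R]_n) (r : R) :
  compact [set x | enorm (x - y) <= r].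
Proof.
apply: bounded_closed_compact.
  exists (r + `|y|); split; first exact: num_real.
  move=> M /ltW rM x /= xr; apply: le_trans rM.
  rewrite -[x](subrK y); apply: le_trans (ler_normD _ _) _.
  by rewrite lerD2r; apply: le_trans xr; exact: mx_norm_le_enorm.
rewrite (_ : mkset _ = (fun x : 'rV[R]_n => enorm (x - y)) @^-1` [set s | s <= r])//.
by apply: closed_comp => [? _|]; [exact: enormB_continuous|exact: closed_le].
Qed.

(** The relation a (3 + gamma) = 4 gives both sides of the equation the same power of w = rho - |x -
    y| on the barrier. What is left is a comparison of coefficients, c^3 a^3 (a - 1) > c^-gamma,
    which is the hypothesis on [c]. *)
Lemma supersolution_lower_growth (Omega : set 'rV[R]_n) (g : R -> R)
    (u : 'rV[R]_n -> R) (y : 'rV[R]_n) (gamma a c r : R) :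
  0 < a -> a * (3 + gamma) = 4 -> 0 < c -> 0 < r ->
  1 < c ^+ 3 * c `^ gamma * (a ^+ 3 * (a - 1)) ->
  open Omega -> [set x | enorm (x - y) <= r] `<=` Omega ->
  {within Omega, continuous u} -> (forall x, Omega x -> 0 < u x) ->
  (forall s, 0 < s -> g s <= s `^ (- gamma)) ->
  viscosity_supersolution Omega g u ->
  u y = c * r `^ a ->
  forall x, enorm (x - y) <= r -> c * (r - enorm (x - y)) `^ a <= u x.
Proof.
move=> a0 ag c0 r0 cbig oO KO; rewrite continuous_open_subspace// => cu u0 gle.
move=> super uy.
(* F >= rho on the closed ball iff u >= c (rho - |x - y|)_+^a there, so
   the first touching radius is min F. *)
pose F x := enorm (x - y) + (u x / c) `^ a^-1.
pose K := [set x | enorm (x - y) <= r].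
have invK t : 0 <= t -> (t `^ a^-1) `^ a = t.
  by move=> t0; rewrite -powRrM mulVf ?powRr1// lt0r_neq0.
have Ky : K y by rewrite /K /= subrr enorm0 ltW.
have cF : {within K, continuous F}.
  apply: continuous_in_subspaceT => x /set_mem /KO Ox.
  have cux : {for x, continuous (fun z => u z / c)}.
    apply: continuousM; last exact: cst_continuous.
    exact/cu/mem_set.
  have ux : 0 < u x / c by rewrite divr_gt0// u0.
  have cp := is_derive1_continuous (is_derive1_powR a^-1 ux).
  exact: (continuousD (@enormB_continuous y x) (continuous_comp cux cp)).
have K0 : K !=set0 by exists y.
have [x1 /set_mem Kx1 minF] :=
  @EVT_min_rV R n F K K0 (@compact_closed_eball y r) cF.
have u10 := u0 _ (KO _ Kx1).
have Fpos x : K x -> 0 < (u x / c) `^ a^-1.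
  by move=> Kx; rewrite powR_gt0// divr_gt0// u0//; exact: KO.
suff rF x : K x -> r <= F x.
  move=> x Kx; rewrite -ler_pdivlMl// mulrC -(invK (u x / c)); last first.
    by rewrite ltW// divr_gt0// u0//; exact: KO.
  apply: ge0_ler_powR; rewrite ?nnegrE ?powR_ge0 ?subr_ge0 ?(ltW a0) //.
  by rewrite lerBlDl; exact: rF.
move=> Kx; apply: le_trans (minF x (mem_set Kx)); rewrite leNgt.
(* Suppose the minimum [rho] of [F] is below [r]. The barrier of radius [rho] then takes the value
   of [u] at the minimiser [x1], which lies strictly inside its support because [F x1] exceeds |x1 -
   y|. *)
apply/negP => Fr; set rho := F x1 in Fr.
pose phi z := c * (rho - enorm (z - y)) `^ a.
have r1rho : enorm (x1 - y) < rho by rewrite ltrDl Fpos.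
have rho0 : 0 < rho by rewrite (le_lt_trans _ r1rho)// sqrtr_ge0.
have [oU CU LU] := @barrier_inf_laplacian y c rho a rho0.
have phi1 : phi x1 = u x1.
  rewrite /phi /rho /F addrAC subrr add0r invK ?ltW ?divr_gt0//.
  by rewrite mulrCA divff ?mulr1// lt0r_neq0.
(* The contact point is not the centre: the normalisation of [u y] gives [F y = r], whereas
   [F x1 < r]. *)
have r1 : 0 < enorm (x1 - y).
  rewrite lt_def sqrtr_ge0 andbT; apply/eqP => e0.
  have x1y : x1 = y.
    apply/subr0_eq/eqP; rewrite -normr_le0 (le_trans (mx_norm_le_enorm _))//.
    by rewrite e0.
  move: Fr; rewrite /rho /F x1y subrr enorm0 add0r uy mulrAC divff ?lt0r_neq0//.
  by rewrite mul1r -powRrM mulfV ?lt0r_neq0// powRr1 ?ltxx// ltW.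
have U1 : 0 < sqdist y x1 < rho ^+ 2.
  have -> : sqdist y x1 = enorm (x1 - y) ^+ 2.
    by rewrite sqr_sqrtr//; apply: sumr_ge0 => i _; exact: sqr_ge0.
  by rewrite exprn_gt0//= ltr_pXn2r ?nnegrE ?ltW.
(* The ball of radius [rho] around [y] is a neighbourhood of [x1] contained in [K], since [rho < r].
   Minimality of [F] there says that the barrier lies below [u]. *)
have touch : \forall z \near x1, u x1 - phi x1 <= u z - phi z.
  have : nbhs x1 [set z | enorm (z - y) < rho].
    apply: open_nbhs_nbhs; split => //.
    rewrite (_ : mkset _ = (fun x : 'rV[R]_n => enorm (x - y)) @^-1` [set s | s < rho])//.
    by apply: open_comp => [? _|]; [exact: enormB_continuous|exact: open_lt].
  apply: filterS => z /= zrho; rewrite phi1 subrr subr_ge0.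
  have Kz : K z by rewrite /K /= ltW// (lt_trans zrho).
  rewrite /phi -ler_pdivlMl// mulrC -(invK (u z / c)); last first.
    by rewrite ltW// divr_gt0// u0//; exact: KO.
  apply: ge0_ler_powR; rewrite ?nnegrE ?powR_ge0 ?subr_ge0 ?(ltW a0) ?(ltW zrho)//.
  by rewrite lerBlDl; exact: (minF z (mem_set Kz)).
have := super x1 _ phi (KO _ Kx1) oU U1 CU touch.
rewrite LU// => /le_trans/(_ (gle _ u10)); apply/negP; rewrite -ltNge -phi1 /phi.
set w := rho - _; have w0 : 0 < w by rewrite subr_gt0.
(* At the contact point u = c w^a, so u^-gamma = c^-gamma w^(3a-4). Dividing by the common power of
   w leaves exactly [cbig]. *)
rewrite powRM ?powR_ge0 ?(ltW c0)// -powRrM.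
have -> : a * - gamma = 3 * a - 4 by rewrite -ag; ring.
rewrite ltr_pM2r ?powR_gt0// powRN -[ltLHS]mul1r ltr_pdivrMr ?powR_gt0//.
by apply: (lt_le_trans cbig); rewrite le_eqVlt; apply/orP; left; apply/eqP; ring.
Qed.

End Barrier.

(** * Distance to the boundary and balls inside the domain *)

Section Domain.
Context {R : realType} {n : nat}.
Implicit Types (A Omega : set 'rV[R]_n) (x z : 'rV[R]_n) (d : R).

(** A sup-norm ball of radius e about a point of the closure lies in [Omega], so e/2 serves all
    nearby points. Compactness, in near-covering form, makes the radius uniform, and boundary points
    of an open set lie outside it. *)
Lemma dist_boundary_gt0 Omega A d : open Omega -> compactly_contained A Omega ->
  dist_set A (boundary Omega) = d%:E -> 0 < d.
Proof.
move=> oO [cA AO] dA.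
pose P (e : R) x := forall z, enorm (x - z) < e -> Omega z.
have cover x : closure A x -> \forall x' \near x & i \near 0^'+, P i x'.
  move=> /AO Ox.
  have /nbhs_ballP[e /= e0 eO] : nbhs x Omega by exact: open_nbhs_nbhs.
  exists (ball x (e / 2), [set i | i < e / 2]).
    split => /=; first by apply: nbhsx_ballx; rewrite divr_gt0.
    by apply: nbhs_right_lt; rewrite divr_gt0.
  move=> [x' i] /= [xx' ie] z zi; apply: eO.
  rewrite [e]splitr; apply: ball_triangle xx' _.
  rewrite -ball_normE /=; apply: le_lt_trans ie; apply: ltW.
  exact: le_lt_trans (mx_norm_le_enorm _) zi.
have /compact_near_coveringP/(_ R 0^'+ P _ cover) Pe := cA.
have : \forall e \near (0:R)^'+, closure A `<=` P e /\ 0 < e.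
  by apply: filterI Pe _; exact: nbhs_right_gt.
move=> /(@filter_ex _ _ (at_right_proper_filter 0))[e [Pe0 e0]].
apply: (lt_le_trans e0); rewrite -lee_fin -dA; apply: le_ereal_inf_tmp.
move=> _ [x Ax [z [_ nOz]] <-]; rewrite lee_fin leNgt; apply/negP => xz.
apply: nOz; move/interior_id : oO => ->.
exact: (Pe0 x (subset_closure Ax) z xz).
Qed.

(** The segment from [x] to [z] stays at distance less than [d] from [x], hence misses the boundary.
    Its trace on [Omega] is then relatively open, relatively closed and contains [x], so it is the
    whole segment. *)
Lemma eball_sub_domain Omega A d x : open Omega -> A `<=` Omega ->
  dist_set A (boundary Omega) = d%:E -> A x -> eball x d `<=` Omega.
Proof.
move=> oO AO dA Ax z zd.
pose L := (fun t : R => t *: (z - x) + x) @` `[0, 1].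
have cL : connected L.
  apply: connected_continuous_connected; first exact: segment_connected.
  apply: continuous_subspaceT => t; apply: cvgD; last exact: cvg_cst.
  exact: scalel_continuous.
have LU : L `&` boundary Omega = set0.
  rewrite -subset0 => _ [[t /=] + <- bt]; rewrite in_itv /= => /andP[t0 t1].
  have : (d%:E <= (enorm (x - (t *: (z - x) + x)))%:E)%E.
    rewrite -dA; apply: ereal_inf_lbound; exists x => //.
    by exists (t *: (z - x) + x).
  rewrite lee_fin opprD addrCA subrr addr0 enormN enormZ ger0_norm//.
  apply/negP; rewrite -ltNge; apply: le_lt_trans zd.
  by rewrite ler_piMl// sqrtr_ge0.
have inL t : 0 <= t <= 1 -> L (t *: (z - x) + x).
  by move=> t01; exists t => //=; rewrite in_itv.
have Lx : L x by have := inL 0; rewrite scale0r add0r; apply; rewrite lexx ler01.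
have Lz : L z by have := inL 1; rewrite scale1r subrK; apply; rewrite lexx ler01.
have LO : L `&` Omega = L.
  apply: cL.
  - by exists x; split => //; exact: AO.
  - by exists Omega.
  (* On the segment [Omega] and its closure have the same trace, because a point of the difference
     would be a boundary point. *)
  - exists (closure Omega); first exact: closed_closure.
    apply/seteqP; split => w [Lw Ow]; split => //; first exact: subset_closure.
    apply: contrapT => nOw; have : (L `&` boundary Omega) w.
      by split => //; split => // /interior_subset.
    by rewrite LU.
by move: Lz; rewrite -LO => -[].
Qed.

End Domain.

(** * Choice of the constants and the growth estimate *)

Theorem theorem6 (R : realType) (n : nat) (gamma M d : R) :
  (0 < n)%N -> 0 <= gamma < 1 ->
  exists C kstar : R, 0 < C /\ 0 < kstar /\
    forall (Omega Omega' : set 'rV[R]_n) (B : R -> R) (eps : R)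
           (u : 'rV[R]_n -> R),
      bounded_smooth_domain Omega ->
      compactly_contained Omega' Omega ->
      dist_set Omega' (boundary Omega) = d%:E ->
      cutoff gamma B ->
      0 < eps ->
      [bounded u x | x in Omega] ->
      Linfty_norm Omega u = M%:E ->
      (forall x, Omega x -> 0 < u x) ->
      viscosity_solution Omega
        (fun s => cutoff_eps gamma B eps s * s `^ (- gamma)) u ->
      forall (x : 'rV[R]_n) (kappa : R),
        Omega' x -> 0 < kappa <= kstar ->
        (ereal_sup [set (u y)%:E | y in eball x kappa]
           <= (C * (kappa `^ alpha gamma + u x))%:E)%E.
Proof.
move=> _ /andP[g0 g1]; set a := alpha gamma.
have ag : a * (3 + gamma) = 4 by rewrite /a /alpha mulfVK// lt0r_neq0//; lra.
have a1 : 1 < a by rewrite /a /alpha ltr_pdivlMr; lra.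
have a0 : 0 < a by lra.
(* For c > c0 both c > 1 and c (a - 1) > 1 hold, which forces the coefficient condition of the
   barrier. *)
pose c0 := 1 + (a - 1)^-1.
have c01 : 1 < c0 by rewrite ltrDl invr_gt0 subr_gt0.
have p20 : 0 < 2 `^ a :> R by rewrite powR_gt0.
(* The factor 2^a comes from the barrier radius 2 kappa. The sign of [d] is unknown at this point,
   and the default 1 is excluded later by [dist_boundary_gt0]. *)
exists (c0 * 2 `^ a), (if 0 < d then d / 4 else 1).
split; first by rewrite mulr_gt0//; lra.
split; first by case: ifPn => // ?; rewrite divr_gt0.
move=> Omega Omega' B eps u [oO _ _ _ _] cOO dOO [_ B01 _ _] _ _ _ u0.
move=> [cu _ super] x k O'x.
have d0 := dist_boundary_gt0 oO cOO dOO; rewrite d0 => /andP[k0 kd].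
have O'O : Omega' `<=` Omega.
  by move=> z O'z; apply: (cOO.2); exact: subset_closure.
have dO := eball_sub_domain oO O'O dOO O'x.
have k20 : 0 < 2 * k by lra.
(* The coarse triangle inequality gives |z - x|^2 <= 2 (4 + 1) k^2 < 16 k^2 <= d^2, whence the bound
   d / 4 on the radius. *)
have ball3 y z : enorm (y - x) <= k -> enorm (z - y) <= 2 * k -> Omega z.
  move=> yx zy; apply: dO; rewrite /eball /=.
  have := sqr_enormD_le (z - y) (y - x); rewrite addrA subrK.
  have := sqrtr_ge0 (\sum_(i < n) (z - x) 0 i ^+ 2); rewrite -/(enorm _).
  have := sqrtr_ge0 (\sum_(i < n) (y - x) 0 i ^+ 2); rewrite -/(enorm _).
  have := sqrtr_ge0 (\sum_(i < n) (z - y) 0 i ^+ 2); rewrite -/(enorm _).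
  by move=> zy0 yx0 zx0; rewrite !expr2; nra.
apply: ge_ereal_sup => _ [y yx <-]; rewrite lee_fin.
have ux0 := u0 _ (O'O _ O'x).
have kk0 : 0 < (2 * k) `^ a by rewrite powR_gt0.
pose c := u y / (2 * k) `^ a.
have uy : u y = c * (2 * k) `^ a by rewrite /c divfK// lt0r_neq0.
have ka0 : 0 <= k `^ a by exact: powR_ge0.
have k2E : (2 * k) `^ a = 2 `^ a * k `^ a by rewrite powRM// ltW.
(* For small c, [u y] is already bounded by a multiple of k^a; for large c, the barrier bounds it by
   a multiple of [u x]. *)
have [cc0|c0c] := leP c c0.
  rewrite mulrDr; apply: (@le_trans _ _ (c0 * 2 `^ a * k `^ a)).
    by rewrite uy k2E mulrA ler_wpM2r// ler_wpM2r// ltW.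
  by rewrite lerDl !mulr_ge0// ltW// (lt_trans _ c01).
have c1 : 1 < c by exact: lt_trans c0c.
have cbig : 1 < c ^+ 3 * c `^ gamma * (a ^+ 3 * (a - 1)).
  have ca : 1 < c * (a - 1).
    have : 1 < c0 * (a - 1).
      by rewrite /c0 mulrDl mulVf ?lt0r_neq0 ?subr_gt0//; lra.
    by move=> /lt_trans; apply; rewrite ltr_pM2r// subr_gt0.
  have -> : c ^+ 3 * c `^ gamma * (a ^+ 3 * (a - 1)) =
    (c * (a - 1)) * (c ^+ 2 * c `^ gamma * a ^+ 3) by ring.
  apply: (lt_le_trans ca); rewrite ler_peMr ?(ltW (lt_trans _ ca))//.
  rewrite mulr_ege1 ?exprn_ege1 ?(ltW a1)//.
  rewrite mulr_ege1 ?exprn_ege1 ?(ltW c1)//.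
  by rewrite -[X in X <= _](powRr0 c) ler_powR// ltW.
(* Bounding the cutoff by 1 removes [eps] from the estimate, so the constants are uniform in it. *)
have gle s : 0 < s ->
    cutoff_eps gamma B eps s * s `^ (- gamma) <= s `^ (- gamma).
  by move=> s0; rewrite ler_piMl ?powR_ge0//; have /andP[] := B01 (s / eps `^ a).
have yO : [set z | enorm (z - y) <= 2 * k] `<=` Omega.
  by move=> z; apply: ball3; exact: ltW.
have xy : enorm (x - y) <= k by rewrite -opprB enormN ltW.
have := supersolution_lower_growth a0 ag (lt_trans ltr01 c1) k20 cbig oO yO cu u0
  gle super uy.
move=> /(_ x) lower.
(* Since |x - y| <= k, at least k of the radius 2k remains at [x]. *)
have {}lower : c * k `^ a <= u x.
  apply: (le_trans _ (lower _)); last by lra.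
  rewrite ler_pM2l ?(lt_trans ltr01 c1)//.
  by apply: ge0_ler_powR; rewrite ?nnegrE; lra.
apply: (@le_trans _ _ (2 `^ a * u x)).
  by rewrite uy k2E mulrCA ler_pM2l.
rewrite mulrDr -[leLHS]add0r lerD//; first by rewrite !mulr_ge0// ltW; lra.
by rewrite ler_pM2r// ler_peMl ?ltW.
Qed.
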